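(* Let $n\ge 1$, and equip $\mathbb{R}^n$ with Lebesgue measure. (1) For all $0<p,q<\infty$ and $\gamma>0$ such that $\gamma=n\left(\frac1p+\frac1q\right)$ there is a finite constant $C_{p,q,n}$ such that for all nonnegative measurable functions $f,g$ on $\mathbb{R}^n$, $$\|f\|_{L^p(\mathbb{R}^n)}\,\|g\|_{L^q(\mathbb{R}^n)}\le C_{p,q,n}\,\sup_{s,t} f(s)g(t)\,|s-t|^\gamma .$$ (2) On the other hand, for $0<p<\infty$ there is no finite constant $C$ such that $$\|f\|_{L^p(\mathbb{R}^n)}\,\|g\|_{L^\infty(\mathbb{R}^n)}\le C\,\sup_{s,t} f(s)g(t)\,|s-t|^{n/p}$$ holds for all nonnegative $f\in L^p(\mathbb{R}^n)$ and $g\in L^\infty(\mathbb{R}^n)$.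
   Context: $\sup$ denotes the essential supremum (here with respect to Lebesgue measure on $\mathbb{R}^n\times\mathbb{R}^n$). For $0<p<\infty$, $\|f\|_{L^p}=(\int|f|^p)^{1/p}$ (also when $p<1$), possibly $+\infty$; the usual convention $0\cdot\infty=0$ is used. *)

(* Defs.v *)
From HB Require Import structures.
From mathcomp Require Import all_boot all_order all_algebra.
From mathcomp Require Import all_classical all_reals all_analysis.

Set Implicit Arguments.
Unset Strict Implicit.
Unset Printing Implicit Defensive.

Import Order.TTheory GRing.Theory Num.Theory.
Import numFieldNormedType.Exports.

Local Open Scope classical_set_scope.
Local Open Scope ring_scope.

Section lebesgue.
Variable R : realType.

Definition cons_pair n (x : measurableTypeR R * n.-tuple (measurableTypeR R)) :
  n.+1.-tuple (measurableTypeR R) := [tuple of x.1 :: x.2].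

Lemma measurable_cons_pair n : measurable_fun [set: _] (@cons_pair n).
Proof. exact: measurable_cons. Qed.

Section step.
Variables (n : nat)
  (mu : {sigma_finite_measure set (n.-tuple (measurableTypeR R)) -> \bar R}).

(* The sigma-algebra on tuples is the product one, here the Borel sets;
   the measure is the product of one-dimensional Lebesgue measures. *)
Definition cons_measure :
    set (n.+1.-tuple (measurableTypeR R)) -> \bar R :=
  pushforward (lebesgue_measure \x mu)%E (@cons_pair n).

Let cons0 : cons_measure set0 = 0%E.
Proof. by rewrite /cons_measure /pushforward preimage_set0 measure0. Qed.

Let cons_ge0 A : (0 <= cons_measure A)%E.
Proof. by rewrite /cons_measure /pushforward measure_ge0. Qed.

Let mcons_preimage A : measurable A -> measurable (@cons_pair n @^-1` A).
Proof.
by move=> mA; rewrite -[X in measurable X]setTI; exact: measurable_cons_pair.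
Qed.

Let cons_sigma_additive : semi_sigma_additive cons_measure.
Proof.
move=> F mF tF mUF; rewrite /cons_measure /pushforward preimage_bigcup.
apply: measure_semi_sigma_additive.
- by move=> i; exact: mcons_preimage.
- apply/trivIsetP => /= i j _ _ ij; rewrite -preimage_setI.
  by move/trivIsetP : tF => /(_ _ _ _ _ ij) ->//; rewrite preimage_set0.
- by rewrite -preimage_bigcup; exact: mcons_preimage.
Qed.

HB.instance Definition _ := isMeasure.Build _ _ _ cons_measure
  cons0 cons_ge0 cons_sigma_additive.

Let cons_sigma_finite : sigma_finite setT cons_measure.
Proof.
have /sigma_finiteP[F [TF ndF Foo]] := sigma_finiteT (@lebesgue_measure R).
have /sigma_finiteP[G [TG ndG Goo]] := sigma_finiteT mu.
pose uncons (t : n.+1.-tuple (measurableTypeR R)) :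
  measurableTypeR R * n.-tuple (measurableTypeR R) :=
  (thead t, [tuple of behead t]).
have unconsK : cancel (@cons_pair n) uncons.
  by move=> [x t]; rewrite /uncons /cons_pair theadE; congr pair; exact/val_inj.
have muncons : measurable_fun setT uncons.
  apply: measurable_fun_pair.
  - exact: measurable_tnth.
  - exact: measurable_behead.
exists (fun k => uncons @^-1` (F k `*` G k)).
  apply/esym/seteqP; split=> // t _.
  have [i _ Fi] : (\bigcup_i F i) (uncons t).1 by rewrite -TF.
  have [j _ Gj] : (\bigcup_i G i) (uncons t).2 by rewrite -TG.
  exists (maxn i j) => //; split.
  - by move: Fi; exact/subsetPset/ndF/leq_maxl.
  - by move: Gj; exact/subsetPset/ndG/leq_maxr.
move=> k; have [mF Fk] := Foo k; have [mG Gk] := Goo k; split.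
  rewrite -[X in measurable X]setTI; apply: muncons => //; exact: measurableX.
rewrite /cons_measure /pushforward -comp_preimage.
rewrite (_ : uncons \o _ = id); last by apply/funext => x /=; rewrite unconsK.
by rewrite preimage_id product_measure1E// lte_mul_pinfty// ge0_fin_numE.
Qed.

HB.instance Definition _ := @Measure_isSigmaFinite.Build _ _ _
  cons_measure cons_sigma_finite.

End step.

Fixpoint borel_lebesgue n :
    {sigma_finite_measure set (n.-tuple (measurableTypeR R)) -> \bar R} :=
  match n with
  | 0 => dirac [tuple]
  | m.+1 => cons_measure (borel_lebesgue m)
  end.

(* Carrier of the sigma-algebra of Lebesgue measurable sets: the Caratheodory
   measurable sets of the Lebesgue outer measure, i.e. the completion of the
   Borel sets. *)
Definition Rn n : Type := caratheodory_type (borel_lebesgue n)^*%mu.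

Definition lebesgue_Rn n : set (Rn n) -> \bar R :=
  @completed_measure_extension _ _ _ (borel_lebesgue n).

Arguments lebesgue_Rn : clear implicits.

Lemma measurable_box n (A : 'I_n -> set (measurableTypeR R)) :
  (forall i, measurable (A i)) ->
  measurable [set t : n.-tuple (measurableTypeR R) | forall i, A i (tnth t i)].
Proof.
move=> mA.
rewrite (_ : mkset _ = \big[setI/setT]_(i < n) (@tnth n _ ^~ i @^-1` A i)).
  apply: bigsetI_measurable => i _; rewrite -[X in measurable X]setTI.
  by apply: measurable_tnth.
rewrite -bigcap_seq; apply/seteqP; split=> t /= At i; first by move=> _; exact: At.
by apply: (At i); rewrite /= mem_index_enum.
Qed.

Lemma borel_lebesgue_box n (A : 'I_n -> set (measurableTypeR R)) :
  (forall i, measurable (A i)) ->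
  borel_lebesgue n [set t | forall i, A i (tnth t i)] =
  (\prod_(i < n) lebesgue_measure (A i))%E.
Proof.
elim: n A => [|n IH] A mA.
  rewrite big_ord0 /= /dirac indicE mem_set// => -[]//.
rewrite big_ord_recl -IH// /= /cons_measure /pushforward.
rewrite -product_measure1E//; last exact: (@measurable_box _ (fun i => A (lift ord0 i))).
congr ((_ \x _)%E _); apply/seteqP; split=> -[x t] /= At.
  split=> [|i]; first by have := At ord0; rewrite tnth0.
  by have := At (lift ord0 i); rewrite tnthS.
by move=> i; case: (unliftP ord0 i) => [j|] ->; rewrite ?tnthS ?tnth0; apply At.
Qed.

Lemma lebesgue_Rn_box n (A : 'I_n -> set (measurableTypeR R)) :
  (forall i, measurable (A i)) ->
  lebesgue_Rn n [set t | forall i, A i (tnth t i)] =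
  (\prod_(i < n) lebesgue_measure (A i))%E.
Proof.
move=> mA; rewrite -borel_lebesgue_box// /lebesgue_Rn.
by rewrite /completed_measure_extension measurable_mu_extE//; exact: measurable_box.
Qed.

HB.instance Definition _ n := Measure.on (lebesgue_Rn n).

Let lebesgue_Rn_sigma_finite n : sigma_finite setT (lebesgue_Rn n).
Proof.
apply: completed_measure_extension_sigma_finite.
exact: (sigma_finiteT (borel_lebesgue n)).
Qed.

HB.instance Definition _ n := @Measure_isSigmaFinite.Build _ _ _
  (lebesgue_Rn n) (lebesgue_Rn_sigma_finite n).

(* The library norm on row vectors is the sup norm, hence this definition. *)
Definition eucl_dist n (s t : Rn n) : R :=
  Num.sqrt (\sum_(i < n) (tnth s i - tnth t i) ^+ 2).

End lebesgue.

Arguments lebesgue_Rn : clear implicits.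

(* Main.v *)
Require Import Defs.
From HB Require Import structures.
From mathcomp Require Import all_boot all_order all_algebra.
From mathcomp Require Import all_classical all_reals all_analysis.
From mathcomp Require Import measurable_realfun ess_sup_inf hoelder.
From mathcomp Require Import ring lra.

(** Let [M] be the essential supremum on the right, and let [A], [B] be the
    essential suprema of [f] and [g].  All the information needed from [M] is
    what it says on one slice: by Fubini, for almost every [t],
    [f s * g t * |s-t|^gamma <= M] for almost every [s].  If [g] does
    not vanish almost everywhere, some such [t = c] has [g c > B/2], so that
    [f s <= min(A, (2M/B) |s-c|^(-gamma))] for almost every [s], and likewise
    for [g] with the two functions exchanged.  Put [rho^gamma = 2M/(AB)]: both
    bounds now read a height times [min(1, (|.|/rho)^(-gamma))], with the same
    radius [rho].  Since [gamma p = n (1 + p/q) > n], such a profile has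
    [L^p] norm at most a constant times [A rho^(n/p)] (Lemma [Lnorm_decay], by
    cutting space into dyadic cubes around [c]), and [g] has [L^q] norm at most
    a constant times [B rho^(n/q)].  The product of the two is a constant times
    [A B rho^gamma = 2M].  This uses [0 < M] and [A, B < +oo].  Both follow from
    one remark ([coupled_superlevel_eq0]): if [f] has a non-negligible
    superlevel set at a height [a] with [M/a] as small as desired, then every
    superlevel set of [g] lies in arbitrarily small cubes, hence is null.

    When [q = +oo] the decay exponent is exactly [n/p], so that the dyadic sum
    diverges logarithmically.  Accordingly, let [g] be the indicator of the unit
    cube and let [f^p] be the sum of [2^(-kn)] times the indicator of the cube
    of radius [2^k], for [k < N].  Each scale contributes [2^n] to the integral
    of [f^p], whereas at any point [s] the nonzero terms form a
    geometric sum at most a constant times [max(1,|s|)^(-n)], so the right-hand side stays bounded as [N]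
    grows. *)

Import Order.TTheory GRing.Theory Num.Theory.
Import numFieldNormedType.Exports.

Local Open Scope classical_set_scope.
Local Open Scope ring_scope.
Local Open Scope ereal_scope.

Set Implicit Arguments.
Unset Strict Implicit.

(** * Cubes and the Euclidean distance *)

(** Balls of the sup norm, whose measure is explicit in every dimension. *)
Definition cube (R : realType) n (c : Rn R n) (r : R) : set (Rn R n) :=
  [set t | forall i : 'I_n, (`|tnth t i - tnth c i| <= r)%R].

Lemma measurable_cube (R : realType) n (c : Rn R n) (r : R) :
  measurable (cube c r).
Proof.
apply: sub_caratheodory; apply: sub_sigma_algebra.
apply: (@measurable_box R n (fun i => [set x | (`|x - tnth c i| <= r)%R])) => i.
rewrite (_ : mkset _ = `[(tnth c i - r)%R, (tnth c i + r)%R]%classic); first exact: measurable_itv.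
by apply/seteqP; split=> x /=; rewrite in_itv/= ler_distl.
Qed.

Lemma lebesgue_cube (R : realType) n (c : Rn R n) (r : R) : (0 <= r)%R ->
  lebesgue_Rn R n (cube c r) = ((2 * r) ^+ n)%:E.
Proof.
move=> r0.
have itvE i : [set x | (`|x - tnth c i| <= r)%R] =
    `[(tnth c i - r)%R, (tnth c i + r)%R]%classic.
  by apply/seteqP; split=> x /=; rewrite in_itv/= ler_distl.
rewrite (@lebesgue_Rn_box R n (fun i => [set x | (`|x - tnth c i| <= r)%R])).
  under eq_bigr => i _.
    rewrite itvE lebesgue_measure_itv/= lte_fin.
    rewrite (_ : (if _ then _ else _) = (2 * r)%:E).
      over.
    have [rr|rr] := ltP; first by rewrite EFinN -EFinD; congr EFin; ring.
    by congr EFin; lra.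
  by rewrite prodEFin prodr_const card_ord.
by move=> i; rewrite itvE; exact: measurable_itv.
Qed.

Lemma cube_eucl_dist (R : realType) n (c s : Rn R n) (r : R) :
  (eucl_dist s c <= r)%R -> cube c r s.
Proof.
move=> sr i; apply: le_trans sr; rewrite -sqrtr_sqr ler_sqrt; last first.
  by apply: sumr_ge0 => j _; exact: sqr_ge0.
by rewrite (bigD1 i)//= lerDl; apply: sumr_ge0 => j _; exact: sqr_ge0.
Qed.

Lemma eucl_distC (R : realType) n (s t : Rn R n) : eucl_dist s t = eucl_dist t s.
Proof. by congr Num.sqrt; apply: eq_bigr => i _; rewrite -sqrrN opprB. Qed.

Lemma eucl_dist_ge0 (R : realType) n (s t : Rn R n) : (0 <= eucl_dist s t)%R.
Proof. exact: sqrtr_ge0. Qed.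

Lemma eucl_dist_le (R : realType) n (s t : Rn R n) (r : R) : (1 <= n)%N -> (0 <= r)%R ->
  (forall i, `|tnth s i - tnth t i| <= r)%R -> (eucl_dist s t <= n%:R * r)%R.
Proof.
move=> n1 r0 st.
rewrite -[leRHS]ger0_norm ?mulr_ge0// -sqrtr_sqr ler_sqrt ?sqr_ge0//.
apply: (@le_trans _ _ (\sum_(i < n) r ^+ 2)%R).
  apply: ler_sum => i _; rewrite -real_normK ?num_real//.
  by rewrite lerXn2r ?nnegrE.
rewrite sumr_const card_ord exprMn -[leLHS]mulr_natl ler_wpM2r ?sqr_ge0//.
by rewrite -natrX ler_nat expnS expn1 leq_pmulr.
Qed.

Lemma lebesgue_Rn_setT_gt0 (R : realType) n : 0 < lebesgue_Rn R n setT.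
Proof.
pose c : Rn R n := [tuple 0%R | i < n].
apply: (@lt_le_trans _ _ (lebesgue_Rn R n (cube c 1))).
  by rewrite lebesgue_cube// mulr1 lte_fin exprn_gt0.
by apply: le_measure; rewrite ?inE//; exact: measurable_cube.
Qed.

(** * Almost everywhere statements, integrals and norms on measure spaces *)

Lemma ae_eq0_of_integral d (T : measurableType d) (R : realType)
    (m : {measure set T -> \bar R}) (h : T -> \bar R) :
  measurable_fun setT h -> (forall x, 0 <= h x) ->
  \int[m]_x h x = 0 -> \forall x \ae m, h x = 0.
Proof.
move=> mh h0 ih; have /(ae_eq_integral_abs m measurableT mh).1 : \int[m]_x `|h x| = 0.
  by under eq_integral do rewrite gee0_abs//.
by apply: filterS => x /(_ I).
Qed.

Section fubini_ae.
Context d1 d2 (T1 : measurableType d1) (T2 : measurableType d2) (R : realType).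
Variables (m1 : {sigma_finite_measure set T1 -> \bar R})
  (m2 : {sigma_finite_measure set T2 -> \bar R}).

(** Both orders of integration of the exceptional set give zero, whichever
    variable is frozen; the definition of the product measure only provides the
    first order, uniqueness of the product measure the second. *)
Lemma ae_prod_sections (P : T1 -> T2 -> Prop) :
  (\forall z \ae (m1 \x m2), P z.1 z.2) ->
  (\forall x \ae m1, \forall y \ae m2, P x y) /\
  (\forall y \ae m2, \forall x \ae m1, P x y).
Proof.
move=> [N [mN N0 PN]]; split.
- have := @ae_eq0_of_integral _ _ _ m1 _ (measurable_fun_xsection m2 mN)
    (fun _ => measure_ge0 _ _) N0.
  apply: filterS => x Nx; exists (xsection N x); split => //.
    exact: measurable_xsection.
  by move=> y /= nP; rewrite /xsection/= inE; apply: PN.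
- have N0' : (m1 \x^ m2) N = 0.
    rewrite -(@product_measure_unique _ _ _ _ _ m1 m2 (m1 \x^ m2))//.
    by move=> A B mA mB; rewrite /= product_measure2E.
  have := @ae_eq0_of_integral _ _ _ m2 _ (measurable_fun_ysection m1 mN)
    (fun _ => measure_ge0 _ _) N0'.
  apply: filterS => y Ny; exists (ysection N y); split => //.
    exact: measurable_ysection.
  by move=> x /= nP; rewrite /ysection/= inE; apply: PN.
Qed.

End fubini_ae.

Lemma ess_sup_prod_ge0 d1 d2 (T1 : measurableType d1) (T2 : measurableType d2)
    (R : realType) (m1 : {sigma_finite_measure set T1 -> \bar R})
    (m2 : {sigma_finite_measure set T2 -> \bar R}) (h : T1 * T2 -> \bar R) :
  0 < m1 setT -> 0 < m2 setT -> (forall z, 0 <= h z) ->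
  0 <= ess_sup (m1 \x m2) h.
Proof.
move=> m1T m2T h0; apply: ess_sup_gee; last by apply: nearW.
by rewrite -setXTT [ltRHS]product_measure1E// mule_gt0.
Qed.

Lemma Lnorm_ess_sup_le0 d (T : measurableType d) (R : realType)
    (mu : {measure set T -> \bar R}) (p : R) (f : T -> \bar R) :
  (0 < p)%R -> measurable_fun setT f -> (forall s, 0 <= f s) ->
  ess_sup mu f <= 0 -> 'N[mu]_(p%:E)[f] = 0.
Proof.
move=> p0 mf f0 /ess_supP fle; rewrite unlock /=.
rewrite (ae_eq_integral (cst 0))//.
- by rewrite integral0 poweR0r// invr_eq0 gt_eqF.
- exact: (measurableT_comp (measurable_poweR _) (measurableT_comp _ mf)).
- apply: filterS fle => s fs _; have -> : f s = 0 by apply/eqP; rewrite eq_le fs f0.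
  by rewrite abse0 poweR0r// gt_eqF.
Qed.

Lemma Lnormy_indic d (T : measurableType d) (R : realType)
    (mu : {measure set T -> \bar R}) (E : set T) : measurable E -> 0 < mu E ->
  'N[mu]_(+oo)[EFin \o \1_E] = 1.
Proof.
move=> mE muE; have muT : 0 < mu setT.
  by apply: lt_le_trans muE _; apply: le_measure; rewrite ?inE.
rewrite unlock muT; apply/eqP; rewrite eq_le; apply/andP; split.
  apply/ess_supP; apply: nearW => x /=.
  by rewrite indicE; case: (_ \in _); rewrite ?normr1 ?normr0 lee_fin.
rewrite leNgt; apply/negP => lt1; move: muE; rewrite lt_neqAle eq_sym => /andP[/eqP + _].
apply; apply: (proj1 (@negligibleP _ _ _ mu _ mE)).
apply: negligibleS (ess_sup_ge mu (abse \o (EFin \o \1_E))) => x Ex /=.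
by rewrite indicE mem_set// normr1 => /le_lt_trans/(_ lt1); rewrite ltxx.
Qed.

Lemma integral_sum_indic d (T : measurableType d) (R : realType)
    (m : {measure set T -> \bar R}) (N : nat) (u : nat -> R) (E : nat -> set T) :
  (forall k, measurable (E k)) -> (forall k, 0 <= u k)%R ->
  \int[m]_x (\sum_(k < N) u k * \1_(E k) x)%:E = \sum_(k < N) (u k)%:E * m (E k).
Proof.
move=> mE u0; under eq_integral do rewrite -sumEFin.
rewrite ge0_integral_sum//.
- apply: eq_bigr => k _; under eq_integral do rewrite EFinM.
  rewrite ge0_integralZl_EFin ?integral_indic ?setIT//.
  by apply/measurable_EFinP; exact: measurable_indic.
- move=> k; apply/measurable_EFinP; exact: measurable_funM.
- by move=> k x _; rewrite lee_fin mulr_ge0.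
Qed.

Lemma nneseries_geometric_le (R : realType) (a x : R) : (0 <= a)%R ->
  (0 < x)%R -> (x < 1)%R ->
  \sum_(0 <= k <oo) (a * x ^+ k)%:E <= (a / (1 - x))%:E.
Proof.
move=> a0 x0 x1.
apply: lime_le.
  by apply: is_cvg_nneseries => k _ _; rewrite lee_fin mulr_ge0// exprn_ge0// ltW.
apply: nearW => m; rewrite sumEFin lee_fin.
have := @geometric_le_lim R m a x a0 x0.
by rewrite gtr0_norm// => /(_ x1).
Qed.

Lemma nneseries_term_le (R : realType) (u : nat -> \bar R) (k : nat) :
  (forall i, 0 <= u i) -> u k <= \sum_(0 <= i <oo) u i.
Proof.
move=> u0; apply: le_trans (nneseries_lim_ge k.+1 (P := xpredT) _) => //.
by rewrite big_nat_recr//= leeDr// sume_ge0.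
Qed.

(** The sets may overlap: at each point, one term of the series of the functions
    [u k * \1_(E k)] suffices to dominate [h], and the others are nonnegative. *)
Lemma integral_le_countable_cover d (T : measurableType d) (R : realType)
    (mu : {measure set T -> \bar R}) (h : T -> \bar R) (E : nat -> set T)
    (u : nat -> R) :
  measurable_fun setT h -> (forall x, 0 <= h x) ->
  (forall k, measurable (E k)) -> (forall k, 0 <= u k)%R ->
  (\forall x \ae mu, exists2 k, E k x & h x <= (u k)%:E) ->
  \int[mu]_x h x <= \sum_(0 <= k <oo) (u k)%:E * mu (E k).
Proof.
move=> mh h0 mE u0 cover.
pose w k x : \bar R := (u k)%:E * (\1_(E k) x)%:E.
have w0 k x : 0 <= w k x by rewrite mule_ge0// lee_fin.
have mind k : measurable_fun setT (fun x => (\1_(E k) x)%:E : \bar R).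
  by apply/measurable_EFinP; exact: measurable_indic.
have mw k : measurable_fun setT (w k) by exact: measurable_funeM.
apply: (@le_trans _ _ (\int[mu]_x \sum_(0 <= k <oo) w k x)).
  apply: ae_ge0_le_integral => //.
  - by move=> x _; apply: nneseries_ge0.
  - exact: ge0_emeasurable_sum.
  apply: filterS cover => x [k Ek hk] _.
  apply: le_trans (nneseries_term_le k (u := w ^~ x) _) => //.
  by rewrite /w indicE mem_set// mule1.
rewrite integral_nneseries//; apply: lee_nneseries => [k _ _|k _].
  exact: integral_ge0.
by rewrite ge0_integralZl_EFin// integral_indic// setIT.
Qed.

(** * Functions bounded by a truncated power of the distance *)

(** The smallest dyadic cube around [c] that contains [s]; by minimality [s] is
    outside the previous cube, except at the smallest scale. *)
Lemma dyadic_cube (R : realType) n (c s : Rn R n) (rho : R) : (0 < rho)%R ->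
  exists2 k : nat, cube c (2 ^+ k.+1 * rho)%R s &
    (k = 0 \/ 2 ^+ k * rho < eucl_dist s c)%R.
Proof.
move=> rho0.
have ex : exists k : nat, `[< cube c (2 ^+ k.+1 * rho)%R s >].
  pose m := Num.truncn (eucl_dist s c / rho).
  exists m; apply/asboolP; apply: cube_eucl_dist.
  rewrite -ler_pdivrMr//; apply: ltW; apply: lt_le_trans (truncnS_gt _) _.
  by rewrite -natrX ler_nat ltnW// ltn_expl.
case: (ex_minnP ex) => k /asboolP ck kmin; exists k => //.
case: k ck kmin => [|k] ck kmin; [by left|right].
rewrite ltNge; apply/negP => /cube_eucl_dist sk.
by have := kmin k (introT (asboolP _) sk); rewrite ltnn.
Qed.

(** The sum over [k] of [4 ^ n * (2 ^ (n - gamma * p)) ^ k], which bounds the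
    integral over the [k]-th dyadic cube when the height [A] and the radius [rho]
    below are both 1. *)
Definition decay_const (R : realType) (n : nat) (p gamma : R) : R :=
  (4 ^+ n / (1 - 2 ^+ n * 2 `^ (- (gamma * p))))%R.

Lemma decay_ratio (R : realType) (n : nat) (p gamma : R) :
  (n%:R < gamma * p)%R -> (0 < 2 ^+ n * 2 `^ (- (gamma * p)) < (1 : R))%R.
Proof.
move=> h; rewrite mulr_gt0 ?powR_gt0//= powRN ltr_pdivrMr ?powR_gt0// mul1r.
rewrite -powR_mulrn// /powR pnatr_eq0/= ltr_expR ltr_pM2r//.
by rewrite ln_gt0// ltr1n.
Qed.

Lemma decay_const_gt0 (R : realType) (n : nat) (p gamma : R) :
  (n%:R < gamma * p)%R -> (0 < decay_const n p gamma)%R.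
Proof.
by move=> /decay_ratio /andP[_ x1]; rewrite divr_gt0 ?exprn_gt0// subr_gt0.
Qed.

(** On the dyadic cube of index [k], the decay hypothesis brings [f] down to
    [A * 2 ^ (- k * gamma)], while the measure of the cube grows as [2 ^ (k * n)].
    The assumption on the exponents makes the resulting series converge. *)
Lemma integral_powR_decay (R : realType) n (p gamma : R) (f : Rn R n -> \bar R)
    (c : Rn R n) (A rho : R) :
  (0 < p)%R -> (0 < gamma)%R -> (n%:R < gamma * p)%R ->
  measurable_fun setT f -> (forall s, 0 <= f s) -> (0 < A)%R -> (0 < rho)%R ->
  (\forall s \ae lebesgue_Rn R n, f s <= A%:E) ->
  (\forall s \ae lebesgue_Rn R n,
     f s * (eucl_dist s c `^ gamma)%:E <= (A * rho `^ gamma)%:E) ->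
  \int[lebesgue_Rn R n]_s (f s `^ p) <= (decay_const n p gamma * (A `^ p * rho ^+ n))%:E.
Proof.
move=> p0 g0 ngp mf f0 A0 rho0 fA fd.
have /andP[x0 x1] := decay_ratio ngp.
pose x : R := (2 `^ (- (gamma * p)))%R.
have xk0 k : (0 <= A `^ p * x ^+ k)%R by rewrite mulr_ge0 ?exprn_ge0 ?powR_ge0.
have mfp : measurable_fun setT (fun s => f s `^ p).
  exact: (measurableT_comp (measurable_poweR _) mf).
apply: le_trans (integral_le_countable_cover (mu := lebesgue_Rn R n) mfp
    (fun=> poweR_ge0 _ _) (fun k => measurable_cube c (2 ^+ k.+1 * rho)) xk0 _) _.
  apply: filterS2 fA fd => s fA fd.
  have [k sk kd] := dyadic_cube c s rho0; exists k => //.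
  move: (f0 s) fA fd; case: (f s) => [a| |]//; rewrite poweR_EFin !lee_fin => a0 aA ad.
  have -> : (x ^+ k = ((2 ^+ k) `^ (- gamma)) `^ p)%R.
    rewrite -[in RHS]powR_mulrn// -!powRrM /x -powR_mulrn ?powR_ge0// -powRrM.
    by congr (_ `^ _)%R; ring.
  rewrite -powRM ?powR_ge0//; last exact: ltW.
  apply: ge0_ler_powR; rewrite ?nnegrE//; first exact: ltW.
    by rewrite mulr_ge0 ?powR_ge0// ltW.
  rewrite powRN ler_pdivlMr ?powR_gt0 ?exprn_gt0//.
  case: kd => [->|kd]; first by rewrite expr0 powR1 mulr1.
  have r0 : (0 < rho `^ gamma)%R by rewrite powR_gt0.
  rewrite -(ler_pM2r r0); apply: le_trans ad.
  rewrite -mulrA -powRM ?exprn_ge0//; last exact: ltW.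
  rewrite ler_wpM2l// ge0_ler_powR ?nnegrE ?eucl_dist_ge0//; first exact: ltW.
    by rewrite mulr_ge0 ?exprn_ge0// ltW.
  exact: ltW.
under eq_eseriesr => k _.
  rewrite [X in _ * X]lebesgue_cube; last by rewrite mulr_ge0 ?exprn_ge0// ltW.
  rewrite -EFinM.
  have -> : (A `^ p * x ^+ k * (2 * (2 ^+ k.+1 * rho)) ^+ n =
    (4 ^+ n * (A `^ p * rho ^+ n)) * (2 ^+ n * x) ^+ k)%R.
    rewrite exprS !exprMn (exprAC 2 k n).
    have -> : (4 ^+ n = 2 ^+ n * 2 ^+ n :> R)%R by rewrite -exprMn -natrM.
    by ring.
  over.
apply: (le_trans (nneseries_geometric_le _ x0 x1)).
  by rewrite !mulr_ge0 ?exprn_ge0 ?powR_ge0// ltW.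
by rewrite lee_fin /decay_const -/x le_eqVlt; apply/orP; left; apply/eqP; ring.
Qed.

Lemma Lnorm_decay (R : realType) n (p gamma : R) (f : Rn R n -> \bar R)
    (c : Rn R n) (A rho : R) :
  (0 < p)%R -> (0 < gamma)%R -> (n%:R < gamma * p)%R ->
  measurable_fun setT f -> (forall s, 0 <= f s) -> (0 < A)%R -> (0 < rho)%R ->
  (\forall s \ae lebesgue_Rn R n, f s <= A%:E) ->
  (\forall s \ae lebesgue_Rn R n,
     f s * (eucl_dist s c `^ gamma)%:E <= (A * rho `^ gamma)%:E) ->
  'N[lebesgue_Rn R n]_(p%:E)[f] <=
    (decay_const n p gamma `^ p^-1 * (A * rho `^ (n%:R / p)))%:E.
Proof.
move=> p0 g0 ngp mf f0 A0 rho0 fA fd.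
have D0 : (0 <= decay_const n p gamma)%R.
  have /andP[_ x1] := decay_ratio ngp.
  by rewrite divr_ge0 ?exprn_ge0// subr_ge0 ltW.
have AR0 : (0 <= A `^ p * rho ^+ n)%R.
  by rewrite mulr_ge0 ?powR_ge0 ?exprn_ge0// ltW.
have pn0 : p != 0%R by rewrite gt_eqF.
rewrite unlock /=; under eq_integral do rewrite gee0_abs//.
have h := integral_powR_decay p0 g0 ngp mf f0 A0 rho0 fA fd.
apply: (@le_trans _ _ ((decay_const n p gamma * (A `^ p * rho ^+ n))%:E `^ p^-1)).
  apply: gt0_ler_poweR => //; first by rewrite invr_ge0 ltW.
  - by rewrite in_itv/= leey andbT; apply: integral_ge0 => s _; exact: poweR_ge0.
  - by rewrite in_itv/= leey andbT lee_fin; exact: mulr_ge0.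
rewrite poweR_EFin lee_fin powRM//.
rewrite powRM ?powR_ge0 ?exprn_ge0//; last exact: ltW.
by rewrite -powRrM mulfV// powRr1 ?(ltW A0)// -powR_mulrn ?(ltW rho0)// -powRrM.
Qed.

(** * Pairs of functions coupled by the distance *)

Section coupled.
Variables (R : realType) (n : nat).
Local Notation mu := (lebesgue_Rn R n).
Implicit Types f g : Rn R n -> \bar R.

Definition superlevel f (a : R) : set (Rn R n) := [set s | a%:E < f s].

Lemma measurable_superlevel f (a : R) : measurable_fun setT f ->
  measurable (superlevel f a).
Proof.
move=> mf; have -> : superlevel f a = setT `&` [set s | a%:E < f s].
  by rewrite setTI.
exact: emeasurable_fun_o_infty.
Qed.

Lemma ess_sup_le_superlevel f (a : R) : measurable_fun setT f ->
  mu (superlevel f a) = 0 -> ess_sup mu f <= a%:E.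
Proof.
move=> mf m0; apply/ess_supP; exists (superlevel f a); split => //.
  exact: measurable_superlevel.
by move=> s /= /negP; rewrite -ltNge.
Qed.

(** The dimension is positive because in dimension 0 all cubes have measure 1. *)
Lemma lebesgue_eq0_small_cubes (E : set (Rn R n)) : (1 <= n)%N -> measurable E ->
  (forall r : R, (0 < r)%R ->
    exists c, \forall t \ae mu, E t -> cube c r t) ->
  mu E = 0.
Proof.
move=> n1 mE sE; apply/eqP; rewrite eq_le measure_ge0 andbT.
apply/lee_addgt0Pr => e e0; rewrite add0e.
(* The side of the cube is [2 * r = min e 1], whose [n]-th power is at most [e]. *)
pose r : R := (Num.min e 1 / 2)%R.
have m0 : (0 < Num.min e 1)%R by rewrite lt_min e0 ltr01.
have r0 : (0 < r)%R by rewrite divr_gt0.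
have [c [N [mN N0 EN]]] := sE r r0.
have -> : e%:E = e%:E + mu N by rewrite N0 adde0.
apply: (@le_trans _ _ (mu (cube c r `|` N))).
  apply: le_measure; rewrite ?inE//.
    by apply: measurableU => //; exact: measurable_cube.
  move=> t Et; have [tc|tc] := pselect (cube c r t); first by left.
  by right; apply: EN => /(_ Et).
apply: le_trans (measureU2 _ _ _) _ => //; first exact: measurable_cube.
rewrite leeD2r// [leLHS]lebesgue_cube ?(ltW r0)// lee_fin /r mulrC divfK//.
case: n n1 => // k _; rewrite exprS.
apply: (@le_trans _ _ (Num.min e 1)%R); last by rewrite ge_min lexx.
rewrite ler_piMr//; first exact: ltW.
by rewrite exprn_ile1 ?(ltW m0)// ge_min lexx orbT.
Qed.

Definition coupled (gamma M : R) f g :=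
  \forall s \ae mu, \forall t \ae mu,
    f s * g t * (eucl_dist s t `^ gamma)%:E <= M%:E.

Variables (gamma M : R) (gamma_gt0 : (0 < gamma)%R) (M_ge0 : (0 <= M)%R).

(** Superlevel sets of positive measure contain points [c] at which the slice of
    [coupled] holds; there [f c] may be replaced with the height [a]. *)
Lemma coupled_slice f g (a : R) : coupled gamma M f g ->
  measurable_fun setT f -> (forall s, 0 <= f s) -> (forall t, 0 <= g t) ->
  (0 < a)%R -> mu (superlevel f a) != 0 ->
  exists c, \forall t \ae mu, g t * (eucl_dist t c `^ gamma)%:E <= (M / a)%:E.
Proof.
move=> fg mf f0 g0 a0 fa.
have [c [ac cM]] : exists c, superlevel f a c /\
    \forall t \ae mu, f c * g t * (eucl_dist c t `^ gamma)%:E <= M%:E.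
  apply/not_existsP => noc.
  move/eqP: fa; apply.
  apply: (proj1 (@negligibleP _ _ _ mu _ (measurable_superlevel a mf))).
  apply: negligibleS fg => s sa sM.
  exact: (noc s).
exists c; apply: filterS cM => t; rewrite (eucl_distC t c) => cM.
rewrite EFinM muleC [in leRHS]muleC lee_pdivlMl// [X in _ * X]muleC.
apply: le_trans cM; rewrite -muleA lee_wpmul2r//; last exact: ltW.
by rewrite mule_ge0// lee_fin powR_ge0.
Qed.

(** Freezing a point where [f] exceeds [a] confines the superlevel set of [g] to
    a ball of radius [(M / (a * b)) ^ (1 / gamma)].  The two uses are [M = 0], and
    [f] essentially unbounded, where [a] can be taken arbitrarily large. *)
Lemma coupled_superlevel_eq0 f g (b : R) : (1 <= n)%N -> coupled gamma M f g ->
  measurable_fun setT f -> measurable_fun setT g ->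
  (forall s, 0 <= f s) -> (forall t, 0 <= g t) -> (0 < b)%R ->
  (forall e : R, (0 < e)%R ->
     exists a : R, [/\ (0 < a)%R, (M / a <= e)%R & mu (superlevel f a) != 0]) ->
  mu (superlevel g b) = 0.
Proof.
move=> n1 fg mf mg f0 g0 b0 big.
apply: lebesgue_eq0_small_cubes => //; first exact: measurable_superlevel.
move=> r r0; have e0 : (0 < b * r `^ gamma)%R by rewrite mulr_gt0 ?powR_gt0.
have [a [a0 aM fa]] := big _ e0.
have [c] := coupled_slice fg mf f0 g0 a0 fa.
move=> cM; exists c; apply: filterS cM => t tM bt.
apply: cube_eucl_dist; rewrite leNgt; apply/negP => rt.
have : (b * r `^ gamma)%:E < (b * r `^ gamma)%:E; last by rewrite ltxx.
apply: (@lt_le_trans _ _ (M / a)%:E); last by rewrite lee_fin.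
apply: lt_le_trans tM.
apply: (@lt_le_trans _ _ (b%:E * (eucl_dist t c `^ gamma)%:E)).
  by rewrite -EFinM lte_fin ltr_pM2l// gt0_ltr_powR ?nnegrE ?eucl_dist_ge0// ltW.
by rewrite lee_wpmul2r ?lee_fin ?powR_ge0// ltW.
Qed.

Lemma coupled_M_gt0 f g (a b : R) : (1 <= n)%N -> coupled gamma M f g ->
  measurable_fun setT f -> measurable_fun setT g ->
  (forall s, 0 <= f s) -> (forall t, 0 <= g t) -> (0 < a)%R -> (0 < b)%R ->
  mu (superlevel f a) != 0 -> mu (superlevel g b) != 0 -> (0 < M)%R.
Proof.
move=> n1 fg mf mg f0 g0 a0 b0 fa /eqP gb; rewrite lt_neqAle M_ge0 andbT.
apply/eqP => M0; apply: gb; apply: (coupled_superlevel_eq0 n1 fg) => // e e0.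
by exists a; rewrite -M0 mul0r; split=> //; exact: ltW.
Qed.

Lemma coupled_ess_sup_lty f g (b : R) : (1 <= n)%N -> coupled gamma M f g ->
  measurable_fun setT f -> measurable_fun setT g ->
  (forall s, 0 <= f s) -> (forall t, 0 <= g t) -> (0 < b)%R ->
  mu (superlevel g b) != 0 -> ess_sup mu f < +oo.
Proof.
move=> n1 fg mf mg f0 g0 b0 /eqP gb; rewrite ltey; apply/eqP => foo.
apply: gb; apply: (coupled_superlevel_eq0 n1 fg) => // e e0.
exists (M / e + 1)%R.
have a0 : (0 < M / e + 1)%R by rewrite ltr_wpDl// divr_ge0// ltW.
split=> //.
  by rewrite ler_pdivrMr// mulrDr mulrC divfK ?gt_eqF// lerDl; rewrite mulr1 ltW.
apply/eqP => /(ess_sup_le_superlevel mf); by rewrite foo leye_eq.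
Qed.

End coupled.

Lemma gt_dim_exponents (R : realType) (n : nat) (p q gamma : R) : (1 <= n)%N ->
  (0 < p)%R -> (0 < q)%R -> gamma = (n%:R * (p^-1 + q^-1))%R ->
  (n%:R < gamma * p)%R /\ (n%:R < gamma * q)%R.
Proof.
move=> n1 p0 q0 ->; have n0 : (0 < n%:R :> R)%R by rewrite ltr0n.
rewrite -!mulrA !mulrDl !mulVf ?gt_eqF// !ltr_pMr// ltrDl ltrDr.
by rewrite !mulr_gt0// invr_gt0.
Qed.

(** The heights and the radius cancel: [rho ^ (n / p) * rho ^ (n / q)] is
    [rho ^ gamma], which is [2 * M / (A * B)]. *)
Lemma coupled_Lnorm (R : realType) n (p q gamma M : R) (f g : Rn R n -> \bar R) :
  (1 <= n)%N -> (0 < p)%R -> (0 < q)%R -> (0 < gamma)%R ->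
  gamma = (n%:R * (p^-1 + q^-1))%R -> (0 <= M)%R ->
  measurable_fun setT f -> measurable_fun setT g ->
  (forall s, 0 <= f s) -> (forall t, 0 <= g t) ->
  coupled gamma M f g -> coupled gamma M g f ->
  'N[lebesgue_Rn R n]_(p%:E)[f] * 'N[lebesgue_Rn R n]_(q%:E)[g] <=
  (decay_const n p gamma `^ p^-1 * decay_const n q gamma `^ q^-1 * (2 * M))%:E.
Proof.
move=> n1 p0 q0 g0 gE M0 mf mg f0 g0' fg gf.
have [ngp ngq] := gt_dim_exponents n1 p0 q0 gE.
have Dp := decay_const_gt0 ngp; have Dq := decay_const_gt0 ngq.
have rhs0 : 0 <= (decay_const n p gamma `^ p^-1 * decay_const n q gamma `^ q^-1 * (2 * M))%:E.
  by rewrite lee_fin !mulr_ge0 ?powR_ge0.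
have [fle|fgt] := leP (ess_sup (lebesgue_Rn R n) f) 0.
  by rewrite (Lnorm_ess_sup_le0 p0 mf f0 fle) mul0e.
have [gle|ggt] := leP (ess_sup (lebesgue_Rn R n) g) 0.
  by rewrite (Lnorm_ess_sup_le0 q0 mg g0' gle) mule0.
have sup_pos h (a : R) : measurable_fun setT h -> a%:E < ess_sup (lebesgue_Rn R n) h ->
    lebesgue_Rn R n (superlevel h a) != 0.
  move=> mh ah; apply/eqP => h0; move: ah; rewrite ltNge.
  by rewrite (ess_sup_le_superlevel mh h0).
have pos_lt (x : \bar R) : 0 < x -> exists2 a : R, (0 < a)%R & a%:E < x.
  case: x => [r| |]// r0; last by exists 1%R; rewrite ?ltry.
  by exists (r / 2)%R; [rewrite divr_gt0|rewrite lte_fin ltr_pdivrMr// ltr_pMr// ltr1n].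
have [a a0 /(sup_pos _ _ mf) fa] := pos_lt _ fgt.
have [b b0 /(sup_pos _ _ mg) gb] := pos_lt _ ggt.
have Mgt0 := coupled_M_gt0 g0 M0 n1 fg mf mg f0 g0' a0 b0 fa gb.
have := coupled_ess_sup_lty g0 M0 n1 fg mf mg f0 g0' b0 gb.
have := coupled_ess_sup_lty g0 M0 n1 gf mg mf g0' f0 a0 fa.
have := ess_sup_ge (lebesgue_Rn R n) f; have := ess_sup_ge (lebesgue_Rn R n) g.
have := sup_pos f ^~ mf; have := sup_pos g ^~ mg.
move: fgt ggt; case: (ess_sup _ f) => [A| |]//; case: (ess_sup _ g) => [B| |]//.
rewrite !lte_fin => A0 B0 supg supf gB fA _ _.
(* The common radius at which both decay bounds meet the heights [A] and [B]. *)
pose rho : R := ((2 * M / (A * B)) `^ gamma^-1)%R.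
have X0 : (0 < 2 * M / (A * B))%R by rewrite divr_gt0 ?mulr_gt0.
have rho0 : (0 < rho)%R by rewrite powR_gt0.
have rhoE : (rho `^ gamma = 2 * M / (A * B))%R.
  by rewrite -powRrM mulVf ?gt_eqF// powRr1// ltW.
(* Any fraction of the heights would do; a half accounts for the factor 2 in the
   definition of [rho]. *)
have Ah : (0 < A / 2 < A)%R by rewrite divr_gt0//= ltr_pdivrMr// ltr_pMr// ltr1n.
have Bh : (0 < B / 2 < B)%R by rewrite divr_gt0//= ltr_pdivrMr// ltr_pMr// ltr1n.
have /andP[Ah0 AhA] := Ah; have /andP[Bh0 BhB] := Bh.
have [c cf] := coupled_slice gf mg g0' f0 Bh0 (supg _ BhB).
have [c' cg] := coupled_slice fg mf f0 g0' Ah0 (supf _ AhA).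
have ME : (M / (B / 2) = A * rho `^ gamma)%R.
  by rewrite rhoE; field; rewrite !gt_eqF.
have ME' : (M / (A / 2) = B * rho `^ gamma)%R.
  by rewrite rhoE; field; rewrite !gt_eqF.
rewrite ME in cf; rewrite ME' in cg.
have Nf := Lnorm_decay p0 g0 ngp mf f0 A0 rho0 fA cf.
have Ng := Lnorm_decay q0 g0 ngq mg g0' B0 rho0 gB cg.
apply: (le_trans (lee_pmul (Lnorm_ge0 _ _ _) (Lnorm_ge0 _ _ _) Nf Ng)).
have rhoD : (rho `^ (n%:R / p) * rho `^ (n%:R / q) = 2 * M / (A * B))%R.
  by rewrite -powRD ?(gt_eqF rho0) ?implybT// -mulrDr -gE rhoE.
by rewrite -EFinM lee_fin mulrACA (mulrACA A) rhoD [(A * B * _)%R]mulrC divfK// mulf_neq0// gt_eqF.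
Qed.

Lemma Lnorm_mul_le_ess_sup (R : realType) (n : nat) (p q gamma : R) : (1 <= n)%N ->
     (0 < p)%R -> (0 < q)%R -> (0 < gamma)%R ->
     gamma = (n%:R * (p^-1 + q^-1))%R ->
     exists C : R, forall f g : Rn R n -> \bar R,
       measurable_fun [set: Rn R n] f -> measurable_fun [set: Rn R n] g ->
       (forall s, 0 <= f s) -> (forall t, 0 <= g t) ->
       'N[lebesgue_Rn R n]_(p%:E)[f] * 'N[lebesgue_Rn R n]_(q%:E)[g] <=
       C%:E * ess_sup (lebesgue_Rn R n \x lebesgue_Rn R n)
                (fun st => f st.1 * g st.2 * (eucl_dist st.1 st.2 `^ gamma)%:E).
Proof.
move=> n1 p0 q0 g0 gE.
exists (decay_const n p gamma `^ p^-1 * decay_const n q gamma `^ q^-1 * 2)%R.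
move=> f g mf mg f0 g0'.
set C := (_ * _ * 2)%R.
have C0 : (0 < C)%R.
  have [ngp ngq] := gt_dim_exponents n1 p0 q0 gE.
  by rewrite !mulr_gt0// powR_gt0// decay_const_gt0.
have := ess_sup_ge (lebesgue_Rn R n \x lebesgue_Rn R n)
  (fun st => f st.1 * g st.2 * (eucl_dist st.1 st.2 `^ gamma)%:E).
set E := ess_sup _ _.
have E0 : 0 <= E.
  apply: ess_sup_prod_ge0 => [||z]; [exact: lebesgue_Rn_setT_gt0..|].
  by rewrite !mule_ge0// lee_fin powR_ge0.
case: E E0 => [M| |]// M0 HM; last by rewrite gt0_muley ?leey// lte_fin.
have [H1 H2] := @ae_prod_sections _ _ _ _ R (lebesgue_Rn R n) (lebesgue_Rn R n)
  (fun s t => f s * g t * (eucl_dist s t `^ gamma)%:E <= M%:E) HM.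
rewrite -EFinM /C -(mulrA _ 2%R M).
have gf : coupled gamma M g f.
  by apply: filterS H2 => t; apply: filterS => s; rewrite eucl_distC (muleC (g t)).
exact: (coupled_Lnorm n1 p0 q0 g0 gE M0 mf mg f0 g0' H1 gf).
Qed.

(** * Failure at the endpoint *)

Section counterexample.
Variables (R : realType) (n : nat) (n_gt0 : (1 <= n)%N).
Local Notation mu := (lebesgue_Rn R n).

Let c0 : Rn R n := [tuple 0%R | i < n].

(** Comparable with [min(1, |s| ^ (- n))] up to a distance of order [2 ^ N], where
    it vanishes.  The overlapping cubes make its integral a plain sum. *)
Definition dyadic_profile (N : nat) (s : Rn R n) : R :=
  (\sum_(k < N) 2 ^- n ^+ k * \1_(cube c0 (2 ^+ k)) s)%R.

Lemma dyadic_profile_ge0 N s : (0 <= dyadic_profile N s)%R.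
Proof. by apply: sumr_ge0 => k _; rewrite mulr_ge0 ?exprn_ge0 ?invr_ge0 ?exprn_ge0. Qed.

Lemma measurable_dyadic_profile N : measurable_fun setT (dyadic_profile N).
Proof.
apply: measurable_sum => k; apply: measurable_funM; first exact: measurable_cst.
by apply: measurable_indic; exact: measurable_cube.
Qed.

Lemma integral_dyadic_profile N :
  \int[mu]_s (dyadic_profile N s)%:E = (N%:R * 2 ^+ n)%:E.
Proof.
rewrite (@integral_sum_indic _ _ _ mu N (fun k => 2 ^- n ^+ k)%R (fun k => cube c0 (2 ^+ k)%R)).
- under eq_bigr => k _.
    rewrite [X in _ * X]lebesgue_cube ?exprn_ge0// -EFinM exprMn mulrCA.
    rewrite (exprAC 2 k n) -exprMn mulVf ?expf_neq0// expr1n mulr1.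
    over.
  by rewrite sumEFin sumr_const card_ord mulr_natl.
- by move=> k; exact: measurable_cube.
- by move=> k; rewrite exprn_ge0// invr_ge0 exprn_ge0.
Qed.

(** The terms that survive form a geometric tail dominated by its first term,
    which is at most [x ^- n].  When [1 < x] the term of index 0
    vanishes, and dividing [x] by 2 shifts the sum by one index without changing
    the product; so induction reduces the claim to [x <= 1]. *)
Lemma dyadic_tail_le (N : nat) (x : R) : (0 <= x)%R ->
  ((\sum_(k < N) 2 ^- n ^+ k * (x <= 2 ^+ k)%R%:R) * x ^+ n <= 2)%R.
Proof.
have z0 : (0 < 2 ^- n :> R)%R by rewrite invr_gt0 exprn_gt0.
have z2 : (2 ^- n <= 2^-1 :> R)%R.
  rewrite lef_pV2 ?posrE ?exprn_gt0//.
  by rewrite -{1}(expr1 2%R) ler_eXn2l// ltr1n.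
elim: N x => [|N IH] x x0; first by rewrite big_ord0 mul0r.
have [x1|x1] := leP x 1%R.
  apply: (@le_trans _ _ (\sum_(0 <= k < N.+1) 1 * 2 ^- n ^+ k)%R); last first.
    have z1 : (2 ^- n < 1 :> R)%R by lra.
    have := @geometric_le_lim R N.+1 1 (2 ^- n)%R ler01 z0.
    rewrite gtr0_norm// => /(_ z1) /le_trans; apply.
    by rewrite mul1r invf_ple ?posrE; lra.
  rewrite big_mkord; apply: (@le_trans _ _ ((\sum_(k < N.+1) 1 * 2 ^- n ^+ k) * 1)%R).
    apply: ler_pM.
    - by apply: sumr_ge0 => k _; rewrite mulr_ge0// exprn_ge0// ltW.
    - by rewrite exprn_ge0.
    - by apply: ler_sum => k _; rewrite mul1r ler_piMr ?lern1 ?leq_b1// exprn_ge0// ltW.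
    - by rewrite exprn_ile1.
  by rewrite mulr1.
rewrite big_ord_recl !expr0 (leNgt x) x1 mulr0 add0r.
apply: le_trans (IH (x / 2)%R _); last by rewrite divr_ge0.
have -> : (x ^+ n = 2 ^+ n * (x / 2) ^+ n)%R.
  by rewrite -exprMn mulrC divfK.
rewrite mulrA ler_wpM2r ?exprn_ge0 ?divr_ge0// mulr_suml.
apply: ler_sum => k _.
have -> : (x <= 2 ^+ lift ord0 k)%R = (x / 2 <= 2 ^+ k)%R.
  by rewrite /= /bump add1n exprSr ler_pdivrMr.
by rewrite /= /bump add1n exprS mulrC !mulrA mulfV ?mul1r.
Qed.

(** If [s] is in the cube of radius [2 ^ k] and [t] in the unit one, then their
    coordinates differ by at most [2 * 2 ^ k], so [eucl_dist s t / (2 * n)] can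
    play the part of [x] in [dyadic_tail_le]. *)
Lemma dyadic_profile_decay N (s t : Rn R n) : cube c0 1 t ->
  (dyadic_profile N s * eucl_dist s t ^+ n <= 2 * (2 * n%:R) ^+ n)%R.
Proof.
move=> tc.
have nn0 : (0 < 2 * n%:R :> R)%R by rewrite mulr_gt0// ltr0n.
pose x := (eucl_dist s t / (2 * n%:R))%R.
have x0 : (0 <= x)%R by rewrite divr_ge0 ?eucl_dist_ge0// ltW.
have -> : eucl_dist s t = (x * (2 * n%:R))%R by rewrite divfK// gt_eqF.
rewrite exprMn mulrA ler_wpM2r ?exprn_ge0 ?(ltW nn0)//.
apply: le_trans (dyadic_tail_le N x0); rewrite ler_wpM2r ?exprn_ge0//.
apply: ler_sum => k _; rewrite ler_wpM2l ?exprn_ge0 ?invr_ge0 ?exprn_ge0//.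
rewrite indicE; have [sk|] := boolP (s \in _); last by [].
rewrite (_ : (x <= 2 ^+ k)%R)// /x ler_pdivrMr//.
apply: le_trans (eucl_dist_le (r := 2 * 2 ^+ k) n_gt0 _ _) _.
- by rewrite mulr_ge0 ?exprn_ge0.
- move=> i; move: sk; rewrite inE => /(_ i) sk; have ti := tc i.
  have -> : (tnth s i - tnth t i = (tnth s i - tnth c0 i) - (tnth t i - tnth c0 i))%R by ring.
  apply: le_trans (ler_normB _ _) _; rewrite mulr_natl mulr2n lerD//.
  by apply: le_trans ti _; rewrite exprn_ege1// ler1n.
- by rewrite le_eqVlt; apply/orP; left; apply/eqP; ring.
Qed.

Lemma no_Lnorm_mul_le_ess_sup (p : R) : (0 < p)%R ->
     ~ exists C : R, forall f g : Rn R n -> R,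
       f \in Lfun (lebesgue_Rn R n) p%:E -> g \in Lfun (lebesgue_Rn R n) +oo ->
       (forall s, 0 <= f s)%R -> (forall t, 0 <= g t)%R ->
       'N[lebesgue_Rn R n]_(p%:E)[EFin \o f] *
       'N[lebesgue_Rn R n]_(+oo)[EFin \o g] <=
       C%:E * ess_sup (lebesgue_Rn R n \x lebesgue_Rn R n)
                (fun st => (f st.1 * g st.2 *
                            eucl_dist st.1 st.2 `^ (n%:R / p))%:E).
Proof.
move=> p0 [C HC].
pose D : R := ((2 * (2 * n%:R) ^+ n) `^ p^-1)%R.
pose K := (`|C| * D)%R.
(* Enough scales for the [p]-th power of the left-hand side, which is at least
   [N], to exceed that of the bound [K] of the right-hand side. *)
pose N := (Num.truncn (K `^ p)).+1.
pose f s := (dyadic_profile N s `^ p^-1)%R.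
pose g : Rn R n -> R := \1_(cube c0 1).
have f0 s : (0 <= f s)%R by exact: powR_ge0.
have g0 t : (0 <= g t)%R by rewrite /g indicE.
have mf : measurable_fun setT f.
  apply: (measurableT_comp (measurable_powR _)).
  exact: measurable_dyadic_profile.
have mg : measurable_fun setT g by apply: measurable_indic; exact: measurable_cube.
have Nf : 'N[mu]_(p%:E)[EFin \o f] = ((N%:R * 2 ^+ n) `^ p^-1)%:E.
  rewrite unlock /=; under eq_integral => s _.
    rewrite ger0_norm// /f -powRrM mulVf ?gt_eqF// powRr1 ?dyadic_profile_ge0//.
    over.
  by rewrite integral_dyadic_profile.
have Ng : 'N[mu]_(+oo)[EFin \o g] = 1.
  apply: Lnormy_indic; first exact: measurable_cube.
  by rewrite [ltRHS]lebesgue_cube// mulr1 lte_fin exprn_gt0.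
have fL : f \in Lfun mu p%:E.
  by rewrite inE; apply/andP; rewrite !inE/=; split=> //; rewrite /finite_norm Nf ltry.
have gL : g \in Lfun mu +oo.
  by rewrite inE; apply/andP; rewrite !inE/=; split=> //; rewrite /finite_norm Ng ltry.
have := HC f g fL gL f0 g0; rewrite Nf Ng mule1.
set h := (fun st : Rn R n * Rn R n => _).
have h0 z : 0 <= h z by rewrite lee_fin !mulr_ge0 ?powR_ge0.
have hD : ess_sup (mu \x mu) h <= D%:E.
  apply/ess_supP; apply: nearW => -[s t] /=; rewrite /h lee_fin /g indicE/=.
  have [tc|_] := boolP (t \in _); last by rewrite mulr0 mul0r powR_ge0.
  rewrite mulr1 mulrC powRrM -powRM ?powR_ge0 ?dyadic_profile_ge0//.
  rewrite powR_mulrn ?eucl_dist_ge0// ge0_ler_powR ?nnegrE ?invr_ge0 ?(ltW p0)//.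
  - by rewrite mulr_ge0 ?exprn_ge0 ?eucl_dist_ge0 ?dyadic_profile_ge0.
  - by rewrite mulrC dyadic_profile_decay//; move: tc; rewrite inE.
have E0 : 0 <= ess_sup (mu \x mu) h.
  by apply: (ess_sup_prod_ge0 _ _ h0); exact: lebesgue_Rn_setT_gt0.
move=> NE.
have : ((N%:R * 2 ^+ n) `^ p^-1)%:E <= K%:E.
  apply: (le_trans NE); rewrite /K EFinM; apply: (@le_trans _ _ (`|C|%:E * ess_sup (mu \x mu) h)).
    apply: (lee_wpmul2r E0); rewrite lee_fin; exact: ler_norm.
  apply: (lee_wpmul2l _ hD); rewrite lee_fin; exact: normr_ge0.
rewrite lee_fin => NK.
have K0 : (0 <= K)%R by rewrite mulr_ge0 ?powR_ge0.
have NKp : (N%:R * 2 ^+ n <= K `^ p)%R.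
  have XE (X : R) : (0 <= X)%R -> (X = (X `^ p^-1) `^ p)%R.
    by move=> X0; rewrite -powRrM mulVf ?gt_eqF// powRr1.
  rewrite (XE (N%:R * 2 ^+ n)%R) ?mulr_ge0 ?exprn_ge0//.
  by apply: ge0_ler_powR NK; rewrite ?nnegrE ?powR_ge0//; exact: ltW.
move: NKp; apply/negP; rewrite -ltNge; apply: lt_le_trans (truncnS_gt _) _.
by rewrite ler_peMr// exprn_ege1// ler1n.
Qed.

End counterexample.

Unset Implicit Arguments.
Set Strict Implicit.

Theorem corollary2p3 (R : realType) (n : nat) (n_ge1 : (1 <= n)%N) :
  (forall p q gamma : R,
     (0 < p)%R -> (0 < q)%R -> (0 < gamma)%R ->
     gamma = (n%:R * (p^-1 + q^-1))%R ->
     exists C : R, forall f g : Rn R n -> \bar R,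
       measurable_fun [set: Rn R n] f -> measurable_fun [set: Rn R n] g ->
       (forall s, 0 <= f s) -> (forall t, 0 <= g t) ->
       'N[lebesgue_Rn R n]_(p%:E)[f] * 'N[lebesgue_Rn R n]_(q%:E)[g] <=
       C%:E * ess_sup (lebesgue_Rn R n \x lebesgue_Rn R n)
                (fun st => f st.1 * g st.2 * (eucl_dist st.1 st.2 `^ gamma)%:E))
  /\
  (forall p : R, (0 < p)%R ->
     ~ exists C : R, forall f g : Rn R n -> R,
       f \in Lfun (lebesgue_Rn R n) p%:E -> g \in Lfun (lebesgue_Rn R n) +oo ->
       (forall s, 0 <= f s)%R -> (forall t, 0 <= g t)%R ->
       'N[lebesgue_Rn R n]_(p%:E)[EFin \o f] *
       'N[lebesgue_Rn R n]_(+oo)[EFin \o g] <=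
       C%:E * ess_sup (lebesgue_Rn R n \x lebesgue_Rn R n)
                (fun st => (f st.1 * g st.2 *
                            eucl_dist st.1 st.2 `^ (n%:R / p))%:E)).
Proof.
split=> [p q gamma p0 q0 g0 gE|p p0].
  exact: (Lnorm_mul_le_ess_sup n_ge1 p0 q0 g0 gE).
exact: (no_Lnorm_mul_le_ess_sup n_ge1 p0).
Qed.
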